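(* Let $\tau\colon\mathbb N\to\mathbb R$ be any sequence with $\lim_{n\to+\infty}\tau(n)=+\infty$. Then there exists a LIP function $f\colon\mathbb Z\to\mathbb Z$ which does not coincide on $\mathbb Z$ with any polynomial in $\mathbb Z[x]$, and an infinite set $X\subseteq\mathbb Z$, such that $|f(x)|<|x|^{\tau(|x|)}$ for all $x\in X$.
   Context: A function $f\colon\mathbb Z\to\mathbb Z$ is LIP on $\mathbb Z$ if for every finite $X\subseteq\mathbb Z$ there is $p\in\mathbb Z[x]$ with $p(x)=f(x)$ for all $x\in X$. *)

(* Defs.v *)
From HB Require Import structures.
From mathcomp Require Import all_boot all_order all_algebra.
From mathcomp Require Import all_classical all_reals all_analysis.

Set Implicit Arguments.
Unset Strict Implicit.
Unset Printing Implicit Defensive.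

Import Order.TTheory GRing.Theory Num.Theory.
Import numFieldNormedType.Exports.

Local Open Scope classical_set_scope.
Local Open Scope ring_scope.

Definition LIP (f : int -> int) : Prop :=
  forall X : set int, finite_set X ->
    exists p : {poly int}, forall x, X x -> p.[x] = f x.

(* Main.v *)
(** For [window y = \prod_(|j| <= y) (X - j)], take [f = \sum_k window (y k)]
    with [y] growing very fast.  Only the terms of index [< k] survive on
    [[-y k, y k]], so [f] is there a polynomial [F k] chosen before [y k]; hence
    [f] is LIP, and picking [y k] so large that [tau (y k)] exceeds the degree of
    [F k] makes [f (y k)] small.  If [f] were a polynomial [p], it would agree
    with [F k] at [2 * y k + 1] points, more than both degrees for large [k], so
    [p = F k] for all large [k]; but [F k.+1 - F k] is monic. *)
Require Import Defs.
From HB Require Import structures.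
From mathcomp Require Import all_boot all_order all_algebra.
From mathcomp Require Import all_classical all_reals all_analysis.
From mathcomp Require Import zify.

Import Order.TTheory GRing.Theory Num.Theory.
Import numFieldNormedType.Exports.

Local Open Scope classical_set_scope.
Local Open Scope ring_scope.

Definition window_seq (n : nat) : seq int :=
  [seq i%:Z - n%:Z | i <- iota 0 n.*2.+1].

Definition window (n : nat) : {poly int} :=
  \prod_(z <- window_seq n) ('X - z%:P).

Lemma mem_window_seq (n : nat) (x : int) : (`|x| <= n)%N -> x \in window_seq n.
Proof.
move=> xn; apply/mapP; exists (absz (x + n%:Z)); last lia.
by rewrite mem_iota; lia.
Qed.

Lemma uniq_window_seq (n : nat) : uniq (window_seq n).
Proof. by rewrite map_inj_uniq ?iota_uniq// => i j; lia. Qed.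

Lemma horner_window (n : nat) (x : int) : (`|x| <= n)%N -> (window n).[x] = 0.
Proof.
by move=> /mem_window_seq xn; apply/rootP; rewrite /window root_prod_XsubC.
Qed.

Lemma window_neq0 (n : nat) : window n != 0.
Proof. exact/monic_neq0/monic_prod_XsubC. Qed.

(** The difference would have [2n + 1] distinct roots, more than its size allows. *)
Lemma poly_eq_on_window (p q : {poly int}) (n : nat) :
  (size p <= n)%N -> (size q <= n)%N ->
  (forall x : int, (`|x| <= n)%N -> p.[x] = q.[x]) -> p = q.
Proof.
move=> sp sq pq; apply/eqP; rewrite -subr_eq0; apply/negPn/negP => pq0.
have rt : all (root (p - q)) (window_seq n).
  apply/allP => x /mapP[i]; rewrite mem_iota => ni ->.
  by rewrite rootE hornerD hornerN pq ?subrr//; lia.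
have := max_poly_roots pq0 rt (uniq_window_seq n).
have := size_polyD p (- q); rewrite size_polyN size_map size_iota.
by move: (size (p - q)) (size p) (size q) sp sq => a b c; lia.
Qed.

Lemma finite_set_absz_bounded (X : set int) :
  finite_set X -> exists N : nat, forall x, X x -> (`|x| <= N)%N.
Proof.
move=> /finite_seqP[s ->]; exists (\max_(x <- s) `|x|%N) => x /= xs.
exact: leq_bigmax_seq.
Qed.

(** The exponent [size p] exceeds the degree by one, so the zero polynomial needs no separate
    case. *)
Lemma normr_horner_le (p : {poly int}) (n : nat) : (0 < n)%N ->
  `|p.[n%:Z]| <= (\sum_(i < size p) `|p`_i|) * n%:Z ^+ size p.
Proof.
move=> n0; rewrite horner_coef mulr_suml.
apply: le_trans (ler_norm_sum _ _ _) _; apply: ler_sum => i _.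
rewrite normrM normrX ler_wpM2l// ler_weXn2l ?(ltnW (ltn_ord i))//; lia.
Qed.

Section SparseSum.
Context {R : realType} (tau : nat -> R).
Hypothesis htau : tau n @[n --> \oo] --> +oo.

Definition admissible (p : {poly int}) (n : nat) : Prop :=
  (size p <= n)%N /\
  (`|p.[n%:Z]|%:~R : R) < (n%:R : R) `^ tau n.

(** With [s = size p] and [C] the sum of the absolute values of the coefficients, a large [n] gives
    [|p(n)| <= C n^s <= n^(s+1) < n^(s+2) <= n^(tau n)]. *)
Lemma exists_admissible (p : {poly int}) (m : nat) :
  exists n, (m < n)%N /\ admissible p n.
Proof.
pose C := \sum_(i < size p) `|p`_i|.
have C0 : 0 <= C by exact: sumr_ge0.
have /cvgryPge/(_ (size p).+2%:R)[N _ Ntau] := htau.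
(* The sum dominates all the lower bounds required of [n] at once. *)
pose n := (N + m + absz C + size p + 2)%N.
have n1 : (1 < n)%N by lia.
exists n; split; [lia | split; [lia |]].
have pn : `|p.[n%:Z]| < n%:Z ^+ (size p).+2.
  apply: le_lt_trans (normr_horner_le _ _ (ltnW n1)) _.
  apply: (@le_lt_trans _ _ (n%:Z ^+ (size p).+1)); last by rewrite ltr_eXn2l//; lia.
  by rewrite exprS ler_wpM2r ?exprn_ge0// -/C; lia.
apply: (@lt_le_trans _ _ ((n%:Z ^+ (size p).+2)%:~R)); first by rewrite ltr_int.
rewrite rmorphXn /= -powR_mulrn ?ler0n// ler_powR ?ler1n ?(ltnW n1)//.
by apply: Ntau; rewrite /= /n; lia.
Qed.

Definition next (p : {poly int}) (m : nat) : nat :=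
  sval (cid (exists_admissible p m)).

Lemma next_gt (p : {poly int}) (m : nat) : (m < next p m)%N.
Proof. by rewrite /next; case: cid => n []. Qed.

Lemma next_admissible (p : {poly int}) (m : nat) : admissible p (next p m).
Proof. by rewrite /next; case: cid => n []. Qed.

(** Each radius is chosen after the polynomial it is paired with, and so can be admissible for
    it. *)
Fixpoint stage (k : nat) : {poly int} * nat :=
  if k is k'.+1 then
    let: (p, m) := stage k' in (p + window m, next (p + window m) m)
  else (0, next 0 0).

Definition partial (k : nat) : {poly int} := (stage k).1.
Definition radius (k : nat) : nat := (stage k).2.

Lemma partialS (k : nat) : partial k.+1 = partial k + window (radius k).
Proof. by rewrite /partial /radius /=; case: stage. Qed.

Lemma radius_ltS (k : nat) : (radius k < radius k.+1)%N.
Proof. by rewrite /radius /=; case: stage => p m; exact: next_gt. Qed.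

Lemma stage_admissible (k : nat) : admissible (partial k) (radius k).
Proof.
case: k => [|k]; first exact: next_admissible.
by rewrite /partial /radius /=; case: stage => p m; exact: next_admissible.
Qed.

Lemma radius_mono (k l : nat) : (k <= l)%N -> (radius k <= radius l)%N.
Proof.
move=> /subnK <-; elim: (l - k)%N => // i IH.
by rewrite addSn; apply: leq_trans IH _; exact/ltnW/radius_ltS.
Qed.

Lemma radius_ge (k : nat) : (k <= radius k)%N.
Proof. by elim: k => // k IH; exact: leq_ltn_trans (radius_ltS k). Qed.

(** Every window added from stage [k] on has radius at least [radius k], so it vanishes at [x]. *)
Lemma partial_stable (k l : nat) (x : int) :
  (k <= l)%N -> (`|x| <= radius k)%N -> (partial l).[x] = (partial k).[x].
Proof.
move=> /subnK <- xk; elim: (l - k)%N => // i IH.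
rewrite addSn partialS hornerD horner_window ?addr0//.
by apply: leq_trans xk _; apply: radius_mono; exact: leq_addl.
Qed.

(** The infinite sum is cut at index [|x|], which loses nothing because [|x| <= radius |x|]. *)
Definition sparse_sum (x : int) : int := (partial `|x|%N).[x].

Lemma sparse_sumE (k : nat) (x : int) :
  (`|x| <= radius k)%N -> sparse_sum x = (partial k).[x].
Proof.
move=> xk; rewrite /sparse_sum.
(* Stability is applied from the smaller of the indices [k] and [|x|]; both radii bound [|x|]. *)
by case: (leqP k `|x|%N) => [|/ltnW] kx; [|symmetry];
  apply: partial_stable => //; exact: radius_ge.
Qed.

Lemma LIP_sparse_sum : LIP sparse_sum.
Proof.
move=> X /finite_set_absz_bounded[N XN]; exists (partial N) => x /XN xN.
by rewrite (sparse_sumE N)//; exact: leq_trans (radius_ge N).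
Qed.

Lemma sparse_sum_not_poly :
  ~ (exists p : {poly int}, forall x : int, p.[x] = sparse_sum x).
Proof.
move=> [p pE].
have pF k : (size p <= k)%N -> p = partial k.
  move=> pk; apply: (poly_eq_on_window _ _ (radius k)).
  - exact: leq_trans (radius_ge k).
  - by have [] := stage_admissible k.
  - by move=> x xk; rewrite pE; exact: sparse_sumE.
(* Both [partial (size p)] and its successor equal [p], so the window between them would be zero. *)
have /eqP := pF _ (leqnSn (size p)).
by rewrite partialS -pF// -subr_eq0 opprD addNKr oppr_eq0 (negPf (window_neq0 _)).
Qed.

End SparseSum.

Theorem theorem6 (R : realType) (tau : nat -> R)
    (htau : tau n @[n --> \oo] --> +oo) :
  exists (f : int -> int) (X : set int),
    [/\ LIP f,
        ~ (exists p : {poly int}, forall x : int, p.[x] = f x),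
        infinite_set X
      & forall x : int, X x ->
          `|f x|%:~R < (`|x|%:~R : R) `^ tau `|x|%N].
Proof.
exists (sparse_sum tau htau), (range (fun k => (radius tau htau k)%:Z)); split.
- exact: LIP_sparse_sum.
- exact: sparse_sum_not_poly.
- move=> /finite_set_absz_bounded[N XN].
  (* [radius] at [N.+1] is at least [N.+1], beyond the supposed bound [N]. *)
  have /XN : range (fun k => (radius tau htau k)%:Z) (radius tau htau N.+1)%:Z by exists N.+1.
  by rewrite absz_nat leqNgt radius_ge.
- move=> _ [k _ <-]; rewrite (sparse_sumE tau htau k) ?absz_nat//.
  by have [_] := stage_admissible tau htau k.
Qed.
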